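(* Let $\mathbf{v}^{\mathrm{initial}}\in\mathbb{C}^N$ and $\mathcal{S}^{\mathrm{uncertain}}\subseteq\mathbb{C}^N$ be such that (I1) $\mathbf{v}^{\mathrm{initial}}$ satisfies the security constraints and $\mathbf{J}_{\mathbf{F}}(\mathbf{v}^{\mathrm{initial}})$ is non-singular; (I2) $\mathcal{S}^{\mathrm{uncertain}}$ is compact and $\mathbf{F}(\mathbf{v}^{\mathrm{initial}})\in\mathcal{S}^{\mathrm{uncertain}}$. Let $f_\ell:\mathbb{C}^N\to\mathbb{R}$, $\ell\in\{1,\dots,\tilde L\}$, be continuous functions such that the set $\tilde{\mathcal{V}}=\{\mathbf{v}\in\mathbb{C}^N: f_\ell(\mathbf{v})>0,\ \ell=1,\dots,\tilde L\}$ is convex and non-singular (i.e. $\mathbf{J}_{\mathbf{F}}(\mathbf{v})$ is non-singular for every $\mathbf{v}\in\tilde{\mathcal{V}}$). Let $f_\ell(\mathbf{v})>0$, $\ell\in\{\tilde L+1,\dots,L\}$, be an enumeration of the security constraints, and let $\mathcal{V}=\{\mathbf{v}\in\mathbb{C}^N: f_\ell(\mathbf{v})>0,\ \ell=1,\dots,L\}$. Suppose that the following three tests succeed: (a) $\mathbf{v}^{\mathrm{initial}}\in\mathcal{V}$; (b) $\mathcal{S}^{\mathrm{uncertain}}$ is connected; (c) for every $\ell\in\{1,\dots,L\}$, the optimization problem $$\min\ \sum_{j=1}^N\big(\mathrm{Re}(v_j)+\mathrm{Im}(v_j)\big)\quad\text{s.t.}\quad f_{\ell'}(\mathbf{v})\ge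 0\ \ \forall \ell'\in\{1,\dots,L\}\setminus\{\ell\},\quad f_\ell(\mathbf{v})=0,\quad \mathbf{F}(\mathbf{v})\in\mathcal{S}^{\mathrm{uncertain}}$$ over $\mathbf{v}\in\mathbb{C}^N$ is infeasible (has no feasible point). Then $\mathcal{S}^{\mathrm{uncertain}}$ is admissible for $\mathbf{v}^{\mathrm{initial}}$.
   Context: Grid model. A single-phase grid has one slack bus (index $0$) with fixed complex voltage $v_0\in\mathbb{C}$ and $N$ $PQ$ buses with index set $\mathcal{N}^{PQ}=\{1,\dots,N\}$. $\mathcal{E}$ is the (finite) set of ordered pairs $jk$ of bus indices in $\{0,\dots,N\}$ such that a branch exists between buses $j$ and $k$. The $(N+1)\times(N+1)$ complex nodal admittance matrix is partitioned as $\mathbf{Y}=\begin{bmatrix}\mathbf{Y}_{00}&\mathbf{Y}_{0L}\\ \mathbf{Y}_{L0}&\mathbf{Y}_{LL}\end{bmatrix}$, where the $N\times N$ matrix $\mathbf{Y}_{LL}$ is invertible. Put $\mathbf{w}=-\mathbf{Y}_{LL}^{-1}\mathbf{Y}_{L0}v_0\in\mathbb{C}^N$. The load-flow function $\mathbf{F}:\mathbb{C}^N\to\mathbb{C}^N$, mapping nodal voltages $\mathbf{v}=(v_1,\dots,v_N)^T$ to nodal power injections, is $$\mathbf{F}(\mathbf{v})=\mathrm{diag}(\mathbf{v})\,\overline{\mathbf{Y}}_{LL}(\overline{\mathbf{v}}-\overline{\mathbf{w}}),$$ where the bar denotes complex conjugation. $\mathbf{J}_{\mathbf{F}}(\mathbf{v})$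 denotes the Jacobian of $\mathbf{F}$ at $\mathbf{v}$, where $\mathbf{F}$ is viewed in rectangular coordinates as a map $\mathbb{R}^{2N}\to\mathbb{R}^{2N}$ of $(\mathrm{Re}(\mathbf{v}),\mathrm{Im}(\mathbf{v}))$. The branch current from bus $j$ to bus $k$ is $i_{jk}=a_{jk}v_0+\mathbf{c}_{jk}^T\mathbf{v}$ with constants $a_{jk}\in\mathbb{C}$, $\mathbf{c}_{jk}\in\mathbb{C}^N$. Security constraints. Given positive real constants $V_j^{\min},V_j^{\max}$ ($j\in\mathcal{N}^{PQ}$) and $I_{jk}^{\max}$ ($jk\in\mathcal{E}$), the security constraints on $\mathbf{v}$ are $$|v_j|^2-(V_j^{\min})^2>0\ \ \forall j\in\mathcal{N}^{PQ},\qquad -|v_j|^2+(V_j^{\max})^2>0\ \ \forall j\in\mathcal{N}^{PQ},\qquad -|a_{jk}v_0+\mathbf{c}_{jk}^T\mathbf{v}|^2+(I_{jk}^{\max})^2>0\ \ \forall jk\in\mathcal{E}.$$ Admissibility. For $\mathbf{v}^{\mathrm{initial}}$ and $\mathcal{S}^{\mathrm{uncertain}}$ satisfying (I1) and (I2), $\mathcal{S}^{\mathrm{uncertain}}$ is admissible for $\mathbf{v}^{\mathrm{initial}}$ if for every continuous function $\mathbf{v}:[0,1]\to\mathbb{C}^N$ with $\mathbf{v}(0)=\mathbf{v}^{\mathrm{initial}}$ and $\mathbf{F}(\mathbf{v}(t))\in\mathcal{S}^{\mathrm{uncertain}}$ for all $t\in[0,1]$, the point $\mathbf{v}(t)$ satisfies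 the security constraints and $\mathbf{J}_{\mathbf{F}}(\mathbf{v}(t))$ is non-singular for all $t\in[0,1]$. *)

(* Defs.v *)
From HB Require Import structures.
From mathcomp Require Import all_boot all_order all_algebra.
From mathcomp Require Import complex.
From mathcomp Require Import all_classical all_reals all_analysis.

Set Implicit Arguments.
Unset Strict Implicit.
Unset Printing Implicit Defensive.

Import Order.TTheory GRing.Theory Num.Theory numFieldNormedType.Exports.
Import complex.

Local Open Scope classical_set_scope.
Local Open Scope ring_scope.

(* The topology of R[i] given by the complex modulus; 'cV[R[i]]_N then carries
   the corresponding (sup-norm) topology of C^N. *)
HB.instance Definition _ (R : rcfType) := NormedModule.copy R[i] R[i]^o.

Notation cvec R N := ('cV[R[i]]_N).

(* Bus 0 is the slack bus; PQ bus number j+1 is indexed by j : 'I_N, as a row of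
   drsubmx, and is rshift 1 j as an element of 'I_(1 + N). *)
Notation bus N := ('I_(1 + N)).

Record grid (R : realType) (N : nat) := Grid {
  slack_voltage : R[i];
  admittance : 'M[R[i]]_(1 + N);
  admittance_LL_unit : drsubmx admittance \in unitmx;
  branches : {set bus N * bus N};
  (* the coefficients a_jk, c_jk matter only for (j, k) in branches *)
  branch_a : bus N * bus N -> R[i];
  branch_c : bus N * bus N -> cvec R N
}.

Record security_limits (R : realType) (N : nat) (G : grid R N) := SecurityLimits {
  Vmin : 'I_N -> R;
  Vmax : 'I_N -> R;
  Imax : bus N * bus N -> R;
  Vmin_gt0 : forall j, 0 < Vmin j;
  Vmax_gt0 : forall j, 0 < Vmax j;
  Imax_gt0 : forall jk, jk \in branches G -> 0 < Imax jk
}.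

Section Grid.
Variables (R : realType) (N : nat) (G : grid R N).

Definition Y_LL : 'M[R[i]]_N := drsubmx (admittance G).
Definition Y_L0 : cvec R N := dlsubmx (admittance G).

Definition zero_load_voltage : cvec R N :=
  - (slack_voltage G *: (invmx Y_LL *m Y_L0)).

Definition load_flow (v : cvec R N) : cvec R N :=
  diag_mx v^T *m map_mx conjc Y_LL
    *m (map_mx conjc v - map_mx conjc zero_load_voltage).

Definition to_rect (v : cvec R N) : 'rV[R]_(N + N) :=
  row_mx (map_mx (@Re R) v^T) (map_mx (@Im R) v^T).

Definition of_rect (x : 'rV[R]_(N + N)) : cvec R N :=
  \col_j (x 0 (lshift N j) +i* x 0 (rshift N j))%C.

(* jacobian is in row-vector convention, hence the transpose. *)
Definition load_flow_jacobian (v : cvec R N) : 'M[R]_(N + N) :=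
  ('J (to_rect \o load_flow \o of_rect) (to_rect v))^T.

Definition nonsingular_at (v : cvec R N) : Prop :=
  load_flow_jacobian v \in unitmx.

Definition nonsingular_set (V : set (cvec R N)) : Prop :=
  forall v, V v -> nonsingular_at v.

Definition branch_current (jk : bus N * bus N) (v : cvec R N) : R[i] :=
  branch_a G jk * slack_voltage G + ((branch_c G jk)^T *m v) 0 0.

Inductive security_index : Type :=
  | MinVoltage of 'I_N
  | MaxVoltage of 'I_N
  | MaxCurrent jk of jk \in branches G.

Variable lim : security_limits G.

Definition security_fun (k : security_index) (v : cvec R N) : R :=
  match k with
  | MinVoltage j => Normc.normc (v j 0) ^+ 2 - Vmin lim j ^+ 2
  | MaxVoltage j => - Normc.normc (v j 0) ^+ 2 + Vmax lim j ^+ 2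
  | MaxCurrent jk _ =>
      - Normc.normc (branch_current jk v) ^+ 2 + Imax lim jk ^+ 2
  end.

Definition secure (v : cvec R N) : Prop := forall k, 0 < security_fun k v.

Definition admissible (vinit : cvec R N) (S : set (cvec R N)) : Prop :=
  forall v : R -> cvec R N,
    {within `[0, 1], continuous v} ->
    v 0 = vinit ->
    (forall t, t \in `[0, 1] -> S (load_flow (v t))) ->
    forall t, t \in `[0, 1] -> secure (v t) /\ nonsingular_at (v t).

Definition enumerates_security (M : nat) (g : 'I_M -> cvec R N -> R) : Prop :=
  exists2 s : 'I_M -> security_index,
    bijective s & forall i, g i = security_fun (s i).

End Grid.

(* convex_set on cvec R N takes its coefficients in R[i]; since 0 <= z <= 1 in
   R[i] forces z to be real, it is ordinary convexity of subsets of C^N. *)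
Definition positivity_set (R : realType) (N L : nat)
    (f : 'I_L -> cvec R N -> R) : set (cvec R N) :=
  [set v | forall l, 0 < f l v].

Record minimization (R : realType) (T : Type) := Minimization {
  objective : T -> R;
  feasible_set : set T
}.

Definition infeasible (R : realType) (T : Type) (P : minimization R T) : Prop :=
  feasible_set P = set0.

Definition boundary_problem (R : realType) (N : nat) (G : grid R N)
    (S : set (cvec R N)) (L : nat) (f : 'I_L -> cvec R N -> R) (l : 'I_L) :
    minimization R (cvec R N) :=
  {| objective := fun v : cvec R N => \sum_(j < N) (Re (v j 0) + Im (v j 0));
     feasible_set := [set v : cvec R N | [/\ forall l', l' != l -> 0 <= f l' v,
                                  f l v = 0 & S (load_flow G v)]] |}.

(* Main.v *)
(** The image P of a path v : [0, 1] -> C^N is connected. On P no f_l can vanish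
    while all the others are nonnegative (test (c)), so the points of P at which
    every f_l is positive are also those at which every f_l is nonnegative. This
    set is open and closed in P and contains v(0), hence is all of P. *)

Require Import Defs.
From mathcomp Require Import all_boot all_order all_algebra.
From mathcomp Require Import complex.
From mathcomp Require Import all_classical all_reals all_analysis.
Import Order.TTheory GRing.Theory Num.Theory numFieldNormedType.Exports.
Local Open Scope classical_set_scope.
Local Open Scope ring_scope.

Lemma connected_positivity (T : topologicalType) (R : realType) (I : finType)
    (f : I -> T -> R) (A : set T) (x0 : T) :
    connected A -> (forall i, continuous (f i)) ->
    (forall i x, A x -> (forall j, j != i -> 0 <= f j x) -> f i x <> 0) ->
    A x0 -> (forall i, 0 < f i x0) ->
  forall x, A x -> forall i, 0 < f i x.
Proof.
move=> cA cf f_neq0 Ax0 f0.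
have fE : A `&` [set x | forall i, 0 < f i x] =
          A `&` [set x | forall i, 0 <= f i x].
  apply/seteqP; split=> x [Ax fx]; split=> // i; first exact: ltW (fx i).
  rewrite lt_neqAle fx andbT eq_sym; apply/eqP.
  by apply: f_neq0 Ax _ => j _; exact: fx.
suff <- : A `&` [set x | forall i, 0 < f i x] = A by move=> x [].
apply: cA; first by exists x0.
- exists [set x | forall i, 0 < f i x] => //.
  (* Openness rests on the finiteness of [I]: the neighbourhoods on which the single [f i] stay
     positive are finitely many, so they intersect in a neighbourhood. *)
  rewrite openE => x /= fx; apply: filter_forall => i.
  have n0 : nbhs (f i x) [set y | 0 < y].
    by apply: open_nbhs_nbhs; split; [exact: open_gt | exact: fx].
  exact: cf n0.
(* The closed witness comes from the weak inequalities; [fE] identifies its trace on [A] with that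
   of the strict ones. *)
- exists (\bigcap_(i in [set: I]) f i @^-1` [set y | 0 <= y]).
    apply: closed_bigI => i _; apply: preimage_closed; last exact: closed_ge.
    by move=> ? _; exact: cf.
  by rewrite fE; congr (_ `&` _); apply/seteqP; split=> x fx i => [_|]; exact: fx.
Qed.

(** The modulus is 1-Lipschitz by the reverse triangle inequality. The topology of [R[i]] comes from
    a norm with values in [R[i]], so radii and distances are moved between [R] and [R[i]]. *)
Lemma continuous_normc (R : realType) : continuous (@Normc.normc R : R[i] -> R).
Proof.
move=> z A /nbhs_ballP[e /= e0 eA].
have e0' : 0 < e%:C%C :> R[i] by rewrite ltcR.
apply/nbhs_ballP; exists e%:C%C => //= y; rewrite /ball /= => zy.
apply: eA; rewrite /ball /= -ltcR; apply: le_lt_trans zy.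
have normE (w : R[i]) : `|w| = (Normc.normc w)%:C%C by case: w.
(* The outer modulus is that of a real number [x], hence the square root of [x ^+ 2 + 0 ^+ 2], which
   is the absolute value of [x]. *)
have := ler_dist_dist z y; by rewrite !{1}normE -rmorphB /= expr0n /= addr0 sqrtr_sqr.
Qed.

Lemma continuous_branch_current (R : realType) (N : nat) (G : grid R N) jk :
  continuous (branch_current G jk).
Proof.
have -> : branch_current G jk = fun v : cvec R N =>
    branch_a G jk * slack_voltage G + \sum_j branch_c G jk j 0 * v j 0.
  by apply/funext => v; rewrite /branch_current mxE; congr (_ + _);
    apply: eq_bigr => j _; rewrite mxE.
move=> v; have FF : Filter (nbhs v) by exact: nbhs_filter.
apply: cvgD; first exact: cvg_cst.
apply: (@cvg_big _ _ _ _ predT) => [|j _]; first exact: add_continuous.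
by apply: cvgMl_tmp; exact: coord_continuous.
Qed.

Lemma continuous_security_fun (R : realType) (N : nat) (G : grid R N)
    (lim : security_limits G) k : continuous (security_fun lim k).
Proof.
(* Each kind of constraint is, up to sign and an additive constant, the squared modulus of a
   continuous complex function. *)
have cn (g : cvec R N -> R[i]) : continuous g ->
    continuous (fun v => Normc.normc (g v) ^+ 2).
  move=> cg v.
  apply: (@continuous_comp _ _ _ g (fun z => Normc.normc z ^+ 2)); first exact: cg.
  apply: (@continuous_comp _ _ _ (@Normc.normc R) (fun r : R => r ^+ 2)).
    exact: continuous_normc.
  exact: exprn_continuous.
case: k => [j|j|jk jkG] v; have FF : Filter (nbhs v) by exact: nbhs_filter.
- apply: cvgB; last exact: cvg_cst.
  by apply: (cn (fun v => v j 0)); exact: coord_continuous.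
- apply: cvgD; last exact: cvg_cst.
  by apply: cvgN; apply: (cn (fun v => v j 0)); exact: coord_continuous.
- apply: cvgD; last exact: cvg_cst.
  by apply: cvgN; apply: (cn (branch_current G jk)); exact: continuous_branch_current.
Qed.

Theorem theorem4 (R : realType) (N : nat) (G : grid R N)
    (lim : security_limits G) (vinit : cvec R N) (S : set (cvec R N))
    (I1_secure : secure lim vinit)
    (I1_nonsingular : nonsingular_at G vinit)
    (I2_compact : compact S)
    (I2_initial : S (load_flow G vinit))
    (Lt M : nat) (f : 'I_(Lt + M) -> cvec R N -> R)
    (f_continuous : forall l : 'I_Lt, continuous (f (lshift M l)))
    (Vt_convex : convex_set (positivity_set (fun l : 'I_Lt => f (lshift M l))))
    (Vt_nonsingular :
       nonsingular_set G (positivity_set (fun l : 'I_Lt => f (lshift M l))))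
    (f_security :
       enumerates_security lim (fun i : 'I_M => f (rshift Lt i)))
    (test_a : positivity_set f vinit)
    (test_b : connected S)
    (test_c : forall l : 'I_(Lt + M), infeasible (boundary_problem G S f l)) :
  admissible lim vinit S.
Proof.
have [s [s' ss' s's] fs] := f_security.
have cf l : continuous (f l).
  case: (split_ordP l) => i ->; first exact: f_continuous.
  by rewrite fs; exact: continuous_security_fun.
move=> v cv v0 Sv t t01.
have fpos : forall l, 0 < f l (v t).
  apply: (connected_positivity _ R _ f (v @` `[0, 1]) vinit) => //.
  - by apply: connected_continuous_connected cv; exact: segment_connected.
  - move=> l _ [r r01 <-] f_ge0 fl0.
    (* A zero of [f l] on the path with the other constraints nonnegative would be feasible for
       problem [l], as the load flow along the path stays in [S]. *)
    suff : feasible_set (boundary_problem G S f l) (v r) by rewrite test_c.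
    by split=> //; exact: Sv.
  - by exists 0; rewrite //= in_itv /= lexx ler01.
(* The first [Lt] inequalities give non-singularity; the last [M] give security, the constraint [k]
   being number [s' k] of the enumeration. *)
split=> [k|]; last by apply: Vt_nonsingular => l; exact: fpos.
by rewrite -(s's k) -fs; exact: fpos.
Qed.
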